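(* Let $c_0\in(0,1)$ be fixed, $r_0=1-c_0^2$, $s_0=5-4c_0^2$, and $B_{c_0}=\frac{1-(5-4c_0^2)^{3/2}+6(1-c_0^2)}{12(5-4c_0^2)}$. The period map $$T:(B_{c_0},0)\to\left(\frac{2\pi\sqrt{s_0}}{(1+4r_0)^{1/4}\sqrt{\sqrt{1+4r_0}-1}},+\infty\right)$$ is a smooth function of $B\in(B_{c_0},0)$ and $\frac{\partial T}{\partial B}>0$.
   Context: For $\alpha\in I_3:=\left(\frac{-1+\sqrt{1+4r_0}}2,\frac{-3+\sqrt{9+48r_0}}4\right)$ put $\beta=-4\alpha^2-4\alpha+3+16r_0>0$, let $k\in(0,1)$ be given by $$k^2=\frac{6\alpha^2+9\alpha-12r_0+\alpha\sqrt3\sqrt\beta}{2\sqrt3\,\alpha\sqrt\beta},$$ let $K(k)=\int_0^1\frac{dt}{\sqrt{(1-k^2t^2)(1-t^2)}}$, and set $T(\alpha)=\frac{2\sqrt{2\sqrt3\,s_0}\,K(k)}{\sqrt{\alpha\sqrt\beta}}$. The energy level is $B(\alpha)=\frac1{s_0}\left(\frac{\alpha^3}3+\frac{\alpha^2}2-r_0\alpha\right)$; the map $\alpha\mapsto B(\alpha)$ is a smooth strictly increasing bijection from $I_3$ onto $(B_{c_0},0)$ with smooth inverse $\alpha=\alpha(B)$. The period map as a function of $B$ is $T(B):=T(\alpha(B))$. ($T$ is the period of the periodic solution $\phi$ of $-\phi''+\frac{r_0}{s_0}\phi-\frac1{s_0}(\phi^3+\phi^5)=0$ satisfying $(\phi')^2=\frac{r_0}{s_0}\phi^2-\frac1{2s_0}\phi^4-\frac1{3s_0}\phi^6+B$,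 with squared maximum $\alpha$.) *)

(* Defs.v *)
(* Stdlib real numbers with Coquelicot. *)
From Stdlib Require Import Reals.
From Coquelicot Require Import Coquelicot.
Open Scope R_scope.

Definition r_of (c0 : R) : R := 1 - c0 ^ 2.
Definition s_of (c0 : R) : R := 5 - 4 * c0 ^ 2.
Definition B_low (c0 : R) : R :=
  (1 - Rpower (5 - 4 * c0 ^ 2) (3 / 2) + 6 * (1 - c0 ^ 2))
  / (12 * (5 - 4 * c0 ^ 2)).

Definition I3 (r0 alpha : R) : Prop :=
  (-1 + sqrt (1 + 4 * r0)) / 2 < alpha < (-3 + sqrt (9 + 48 * r0)) / 4.

Definition beta (r0 alpha : R) : R :=
  - 4 * alpha ^ 2 - 4 * alpha + 3 + 16 * r0.

(* The nonnegative root of the expression given for k^2, which lies in (0,1)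
   for alpha in I3. *)
Definition modulus (r0 alpha : R) : R :=
  sqrt ((6 * alpha ^ 2 + 9 * alpha - 12 * r0
         + alpha * sqrt 3 * sqrt (beta r0 alpha))
        / (2 * sqrt 3 * alpha * sqrt (beta r0 alpha))).

(* The integrand is singular at t = 1, hence an improper Riemann integral. *)
Definition ellipticK (k : R) : R :=
  RInt_gen (fun t => 1 / sqrt ((1 - k ^ 2 * t ^ 2) * (1 - t ^ 2)))
           (at_point 0) (at_left 1).

Definition period_alpha (r0 s0 alpha : R) : R :=
  2 * sqrt (2 * sqrt 3 * s0) * ellipticK (modulus r0 alpha)
  / sqrt (alpha * sqrt (beta r0 alpha)).

Definition energy (r0 s0 alpha : R) : R :=
  1 / s0 * (alpha ^ 3 / 3 + alpha ^ 2 / 2 - r0 * alpha).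

(* Inverse of [energy] restricted to I3: [iota P] is the unique real number
   satisfying P whenever there is exactly one ([iota_correct]).  Its value is
   irrelevant for B outside the range of [energy] on I3. *)
Definition alpha_of_energy (r0 s0 B : R) : R :=
  iota (fun alpha : R => I3 r0 alpha /\ energy r0 s0 alpha = B).

Definition period (r0 s0 B : R) : R :=
  period_alpha r0 s0 (alpha_of_energy r0 s0 B).

(* C^infinity on the open interval (a, b). *)
Definition smooth_on (f : R -> R) (a b : R) : Prop :=
  forall (n : nat) (x : R), a < x < b -> ex_derive_n f n x.

(* Main.v *)
(* The period is a multiple of int_0^oo dx / sqrt ((x^2 + a^2) (x^2 + b^2)), whose integrand is
   invariant under x -> ab / x.  Folding at x = sqrt (ab) and putting x = sqrt (ab) y gives
     T = 4 sqrt (3 s) * int_0^1 dy / sqrt (ab (1 + y^4) + (a^2 + b^2) y^2),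
   where b / a is the complementary modulus.  If alpha > p > 0 > - g are the roots of the
   cubic governing phi^2, then a^2 = alpha (p + g) and b^2 = p (alpha + g), so ab and
   a^2 + b^2 are symmetric in alpha and p, hence functions of sigma = alpha + p alone.  Both
   are increasing in sigma, and sigma decreases as alpha (or B) increases: the integrand
   increases pointwise.  The lower bound is the value at alpha = p, where a = b and the
   integral is elementary.  Smoothness follows by differentiating under this proper
   integral, whose integrand is smooth. *)
Require Import Defs.
From Stdlib Require Import Reals Lra.
From Coquelicot Require Import Coquelicot.
Open Scope R_scope.

(** * Real powers, and functions of class C^n on an open set *)

Lemma is_derive_Rpower (q x : R) (hx : 0 < x) :
  is_derive (fun y => Rpower y q) x (q * Rpower x (q - 1)).
Proof. apply is_derive_Reals. now apply derivable_pt_lim_power. Qed.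

Lemma continuous_Rpower (q x : R) (hx : 0 < x) :
  continuous (fun y => Rpower y q) x.
Proof.
  apply (ex_derive_continuous (fun y => Rpower y q)).
  eexists. now apply is_derive_Rpower.
Qed.

Lemma Rpower_gt_0 (x q : R) : 0 < Rpower x q.
Proof. apply exp_pos. Qed.

(* Continuity is put at level 0, so that the derivative in [Cn 1] is continuous. *)
Fixpoint Cn (D : R -> Prop) (n : nat) (f : R -> R) : Prop :=
  match n with
  | O => forall x, D x -> continuous f x
  | S m => exists g, (forall x, D x -> is_derive f x (g x)) /\ Cn D m g
  end.

Lemma Cn_ext (D : R -> Prop) (open_D : open D) (n : nat) (f g : R -> R) :
  (forall x, D x -> f x = g x) -> Cn D n f -> Cn D n g.
Proof.
  intros E. destruct n as [|n]; simpl.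
  - intros H x hx. apply (continuous_ext_loc g f x).
    + apply (filter_imp D); [exact E | now apply open_D].
    + now apply H.
  - intros [h [H1 H2]]. exists h. split; [|exact H2].
    intros x hx. apply (is_derive_ext_loc f).
    + apply (filter_imp D); [exact E | now apply open_D].
    + now apply H1.
Qed.

Lemma Cn_pred (D : R -> Prop) (n : nat) (f : R -> R) : Cn D (S n) f -> Cn D n f.
Proof.
  revert f; induction n as [|n IH]; intros f [g [H1 H2]].
  - intros x hx. apply (ex_derive_continuous f). exists (g x). now apply H1.
  - exists g. split; [exact H1|]. now apply IH.
Qed.

Lemma Cn_const (D : R -> Prop) (n : nat) (c : R) : Cn D n (fun _ => c).
Proof.
  revert c; induction n as [|n IH]; intros c.
  - intros x _. apply continuous_const.
  - exists (fun _ => 0). split; [|apply IH]. intros x _. apply (is_derive_const c x).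
Qed.

Lemma Cn_plus (D : R -> Prop) (n : nat) (f g : R -> R) :
  Cn D n f -> Cn D n g -> Cn D n (fun x => f x + g x).
Proof.
  revert f g; induction n as [|n IH]; intros f g.
  - intros Hf Hg x hx. apply (continuous_plus f g); auto.
  - intros [f' [Hf Hf']] [g' [Hg Hg']]. exists (fun x => f' x + g' x).
    split; [|now apply IH]. intros x hx. apply (is_derive_plus f g); auto.
Qed.

Lemma Cn_mult (D : R -> Prop) (n : nat) (f g : R -> R) :
  Cn D n f -> Cn D n g -> Cn D n (fun x => f x * g x).
Proof.
  revert f g; induction n as [|n IH]; intros f g.
  - intros Hf Hg x hx. apply (continuous_mult f g); auto.
  - intros Hf Hg. pose proof (Cn_pred _ _ _ Hf). pose proof (Cn_pred _ _ _ Hg).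
    destruct Hf as [f' [Hf Hf']], Hg as [g' [Hg Hg']].
    exists (fun x => f' x * g x + f x * g' x).
    split; [|apply Cn_plus; now apply IH].
    intros x hx. apply (is_derive_mult f g); auto. intros; apply Rmult_comm.
Qed.

(** All exponents are treated together, because each differentiation lowers the exponent by one. *)
Lemma Cn_Rpower (D : R -> Prop) (n : nat) (q : R) (f : R -> R) :
  (forall x, D x -> 0 < f x) -> Cn D n f -> Cn D n (fun x => Rpower (f x) q).
Proof.
  intros pos. revert q; induction n as [|n IH]; intros q Hf.
  - intros x hx. apply (continuous_comp f (fun y => Rpower y q)); [now apply Hf|].
    apply continuous_Rpower. auto.
  - pose proof (Cn_pred _ _ _ Hf) as Hf0. destruct Hf as [f' [Hf Hf']].
    exists (fun x => f' x * (q * Rpower (f x) (q - 1))). split.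
    + intros x hx. apply (is_derive_comp (fun y => Rpower y q) f); [|auto].
      apply is_derive_Rpower. auto.
    + apply Cn_mult; [exact Hf'|]. apply Cn_mult; [apply Cn_const | now apply IH].
Qed.

(** [Cn] takes the first derivative off from the inside, [ex_derive_n] the last one from the
    outside. The two agree because the n-th derivative of f' is the (n+1)-st of f, an identity that
    must hold on a neighbourhood of x. *)
Lemma Cn_ex_derive_n (D : R -> Prop) (open_D : open D) (n : nat) (f : R -> R) (x : R) :
  Cn D n f -> D x -> ex_derive_n f n x.
Proof.
  revert f x. induction n as [|n IH]; intros f x; [intros; exact I|].
  intros [g [H1 H2]] hx. destruct n as [|n].
  - exists (g x). now apply H1.
  - change (ex_derive (Derive_n f (S n)) x).
    apply (ex_derive_ext_loc (Derive_n g n)).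
    + apply (filter_imp D); [|now apply open_D]. intros y hy.
      replace (S n) with (n + 1)%nat by (rewrite Nat.add_comm; reflexivity).
      rewrite <- (Derive_n_comp f n 1). apply Derive_n_ext_loc.
      apply (filter_imp D); [|now apply open_D]. intros z hz.
      symmetry. apply is_derive_unique. now apply H1.
    + exact (IH g x H2 hx).
Qed.

(** * Integrals of powers of a palindromic quartic, and differentiation under the integral sign *)

Definition quartic (S P y : R) : R := S * (1 + y ^ 4) + P * y ^ 2.

Lemma quartic_gt_0 (S P y : R) (hS : 0 < S) (hP : 0 < P) : 0 < quartic S P y.
Proof.
  unfold quartic. assert (0 <= y ^ 2) by apply pow2_ge_0.
  assert (0 <= P * y ^ 2) by (apply Rmult_le_pos; lra).
  assert (0 < S * (1 + y ^ 4)); [|lra].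
  apply Rmult_lt_0_compat; [exact hS|].
  replace (y ^ 4) with (y ^ 2 * y ^ 2) by ring.
  assert (0 <= y ^ 2 * y ^ 2) by (now apply Rmult_le_pos). lra.
Qed.

(** The weight w and the exponent q are free so that the family is closed under differentiation in S
    and P: a derivative lowers q by one and multiplies w by a polynomial. *)
Definition quartic_int (w : R -> R) (q S P : R) : R :=
  RInt (fun y => w y * Rpower (quartic S P y) q) 0 1.

Lemma continuous_quartic_Rpower (w : R -> R) (q S P y : R) :
  0 < S -> 0 < P -> continuous w y ->
  continuous (fun y => w y * Rpower (quartic S P y) q) y.
Proof.
  intros hS hP Hw. apply (continuous_mult w); [exact Hw|].
  apply (continuous_comp (quartic S P) (fun u => Rpower u q)).
  - apply (ex_derive_continuous (quartic S P)). unfold quartic. now auto_derive.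
  - apply continuous_Rpower. now apply quartic_gt_0.
Qed.

Lemma ex_RInt_quartic (w : R -> R) (q S P : R) :
  0 < S -> 0 < P -> (forall y, continuous w y) ->
  ex_RInt (fun y => w y * Rpower (quartic S P y) q) 0 1.
Proof.
  intros hS hP Hw. apply (ex_RInt_continuous (V := R_CompleteNormedModule)).
  intros y _. now apply continuous_quartic_Rpower.
Qed.

Lemma continuous_2d_quartic (S P : R -> R) (x t : R) :
  continuous S x -> continuous P x ->
  continuous (fun z : R * R => quartic (S (fst z)) (P (fst z)) (snd z)) (x, t).
Proof.
  intros HS HP. unfold quartic.
  assert (Hp : forall n c, continuous (fun z : R * R => c + snd z ^ n) (x, t)).
  { intros n c. apply (continuous_comp snd (fun y : R => c + y ^ n)).
    - apply continuous_snd.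
    - apply (ex_derive_continuous (fun y : R => c + y ^ n)). now auto_derive. }
  apply (continuous_plus (fun z : R * R => S (fst z) * (1 + snd z ^ 4))
           (fun z => P (fst z) * snd z ^ 2)).
  - apply (continuous_mult (fun z : R * R => S (fst z))); [|apply Hp].
    apply (continuous_comp fst S); [apply continuous_fst | exact HS].
  - apply (continuous_mult (fun z : R * R => P (fst z))).
    + apply (continuous_comp fst P); [apply continuous_fst | exact HP].
    + apply (continuous_ext (fun z : R * R => 0 + snd z ^ 2));
        [intros z; apply Rplus_0_l | apply Hp].
Qed.

(** [quartic] is linear in its coefficients, so its derivative in x is the quartic with coefficients
    S' and P'. Continuity of S' and P' at x makes the partial derivative of the integrand jointly
    continuous. *)
Lemma is_derive_quartic_int (D : R -> Prop) (open_D : open D)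
  (w : R -> R) (q : R) (S P S' P' : R -> R) (x : R) :
  (forall y, continuous w y) ->
  (forall x, D x -> 0 < S x) -> (forall x, D x -> 0 < P x) ->
  (forall x, D x -> is_derive S x (S' x)) -> (forall x, D x -> is_derive P x (P' x)) ->
  continuous S' x -> continuous P' x -> D x ->
  is_derive (fun x => quartic_int w q (S x) (P x)) x
    (RInt (fun y => w y * (quartic (S' x) (P' x) y
                           * (q * Rpower (quartic (S x) (P x) y) (q - 1)))) 0 1).
Proof.
  intros Hw hS hP HS HP CS' CP' hx.
  assert (Hd : forall u y, D u ->
    is_derive (fun u => w y * Rpower (quartic (S u) (P u) y) q) u
      (w y * (quartic (S' u) (P' u) y * (q * Rpower (quartic (S u) (P u) y) (q - 1))))).
  { intros u y hu.
    apply (is_derive_scal (fun u => Rpower (quartic (S u) (P u) y) q) u (w y)).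
    apply (is_derive_comp (fun z => Rpower z q) (fun u => quartic (S u) (P u) y)).
    - apply is_derive_Rpower. apply quartic_gt_0; auto.
    - unfold quartic.
      apply (is_derive_plus (fun u => S u * (1 + y ^ 4)) (fun u => P u * y ^ 2)).
      + apply (is_derive_scal_l (V := R_NormedModule) S u (S' u) (1 + y ^ 4)). auto.
      + apply (is_derive_scal_l (V := R_NormedModule) P u (P' u) (y ^ 2)). auto. }
  unfold quartic_int.
  (* The derivative is left open, to be unified with the integral of [Derive] supplied by the
     parametric theorem; the integrands are compared last. *)
  erewrite RInt_ext.
  - apply (is_derive_RInt_param (fun x y => w y * Rpower (quartic (S x) (P x) y) q)).
    + apply (filter_imp D); [|now apply open_D]. intros u hu t _. eexists. now apply Hd.
    + intros t _. apply (continuity_2d_pt_ext_loc (fun u y =>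
        w y * (quartic (S' u) (P' u) y * (q * Rpower (quartic (S u) (P u) y) (q - 1))))).
      { destruct (open_D x hx) as [d Hdl]. exists d. intros u v hu _.
        symmetry. apply is_derive_unique. apply Hd. now apply Hdl. }
      apply continuity_2d_pt_filterlim.
      apply (continuous_mult (fun z : R * R => w (snd z))
        (fun z => quartic (S' (fst z)) (P' (fst z)) (snd z)
                 * (q * Rpower (quartic (S (fst z)) (P (fst z)) (snd z)) (q - 1)))).
      { apply (continuous_comp snd w); [apply continuous_snd | apply Hw]. }
      apply (continuous_mult (fun z : R * R => quartic (S' (fst z)) (P' (fst z)) (snd z))).
      { now apply continuous_2d_quartic. }
      apply (continuous_mult (fun z : R * R => q)); [apply continuous_const|].
      apply (continuous_comp (fun z : R * R => quartic (S (fst z)) (P (fst z)) (snd z))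
               (fun u => Rpower u (q - 1))).
      * apply continuous_2d_quartic;
          [apply (ex_derive_continuous S) | apply (ex_derive_continuous P)];
          eexists; eauto.
      * apply continuous_Rpower. apply quartic_gt_0; auto.
    + apply (filter_imp D); [|now apply open_D]. intros u hu.
      apply ex_RInt_quartic; auto.
  - intros y _. simpl. symmetry. apply is_derive_unique. now apply Hd.
Qed.

(** Induction on n for all w and q at once: by [HD] the derivative is a combination of two members
    of the family, with coefficients S' and P'. *)
Lemma Cn_quartic_int (D : R -> Prop) (open_D : open D) (n : nat)
  (w : R -> R) (q : R) (S P : R -> R) :
  (forall y, continuous w y) ->
  (forall x, D x -> 0 < S x) -> (forall x, D x -> 0 < P x) ->
  (forall m, Cn D m S) -> (forall m, Cn D m P) ->
  Cn D n (fun x => quartic_int w q (S x) (P x)).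
Proof.
  intros Hw hS hP CS CP.
  destruct (CS 2%nat) as [S' [HS' [S'' [HS'' _]]]].
  destruct (CP 2%nat) as [P' [HP' [P'' [HP'' _]]]].
  (* The derivative furnished at each order agrees with S' on D, so S' itself has every order. *)
  assert (CS' : forall m, Cn D m S').
  { intros m. destruct (CS (Datatypes.S m)) as [T [HT1 HT2]].
    apply (Cn_ext D open_D m T); [|exact HT2]. intros x hx.
    rewrite <- (is_derive_unique _ _ _ (HT1 x hx)). now apply is_derive_unique, HS'. }
  assert (CP' : forall m, Cn D m P').
  { intros m. destruct (CP (Datatypes.S m)) as [T [HT1 HT2]].
    apply (Cn_ext D open_D m T); [|exact HT2]. intros x hx.
    rewrite <- (is_derive_unique _ _ _ (HT1 x hx)). now apply is_derive_unique, HP'. }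
  assert (HD : forall w q, (forall y, continuous w y) -> forall x, D x ->
    is_derive (fun x => quartic_int w q (S x) (P x)) x
      (S' x * quartic_int (fun y => q * (1 + y ^ 4) * w y) (q - 1) (S x) (P x)
       + P' x * quartic_int (fun y => q * y ^ 2 * w y) (q - 1) (S x) (P x))).
  { clear w q Hw. intros w q Hw x hx.
    assert (W1 : forall y, continuous (fun y => q * (1 + y ^ 4) * w y) y).
    { intros y. apply (continuous_mult (fun y => q * (1 + y ^ 4)) w); [|apply Hw].
      apply (ex_derive_continuous (fun y => q * (1 + y ^ 4))). now auto_derive. }
    assert (W2 : forall y, continuous (fun y => q * y ^ 2 * w y) y).
    { intros y. apply (continuous_mult (fun y => q * y ^ 2) w); [|apply Hw].
      apply (ex_derive_continuous (fun y => q * y ^ 2)). now auto_derive. }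
    assert (E : RInt (fun y => w y * (quartic (S' x) (P' x) y
                           * (q * Rpower (quartic (S x) (P x) y) (q - 1)))) 0 1 =
      S' x * quartic_int (fun y => q * (1 + y ^ 4) * w y) (q - 1) (S x) (P x)
       + P' x * quartic_int (fun y => q * y ^ 2 * w y) (q - 1) (S x) (P x)).
    { unfold quartic_int.
      apply is_RInt_unique.
      apply (is_RInt_ext (fun y =>
         S' x * (q * (1 + y ^ 4) * w y * Rpower (quartic (S x) (P x) y) (q - 1)) +
         P' x * (q * y ^ 2 * w y * Rpower (quartic (S x) (P x) y) (q - 1)))).
      + intros y _. unfold quartic at 3. simpl. ring.
      + apply (is_RInt_plus (V := R_NormedModule));
          apply (is_RInt_scal (V := R_NormedModule));
          apply (RInt_correct (V := R_CompleteNormedModule));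
          apply ex_RInt_quartic; auto. }
    rewrite <- E. apply (is_derive_quartic_int D); auto.
    - exact (CS' 0%nat x hx).
    - exact (CP' 0%nat x hx). }
  revert w q Hw. induction n as [|n IH]; intros w q Hw.
  - intros x hx. apply (ex_derive_continuous (fun x => quartic_int w q (S x) (P x))).
    eexists. now apply HD.
  - eexists. split; [intros x hx; now apply HD|].
    apply Cn_plus; apply Cn_mult; auto; apply IH; intros y.
    + apply (continuous_mult (fun y => q * (1 + y ^ 4)) w); [|apply Hw].
      apply (ex_derive_continuous (fun y => q * (1 + y ^ 4))). now auto_derive.
    + apply (continuous_mult (fun y => q * y ^ 2) w); [|apply Hw].
      apply (ex_derive_continuous (fun y => q * y ^ 2)). now auto_derive.
Qed.

(** * Legendre's complete integral, with complementary modulus c, as a quartic integral *)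

Lemma Rpower_inv_sqrt (x : R) (hx : 0 < x) : Rpower x (-1 / 2) = / sqrt x.
Proof.
  replace (-1 / 2) with (- / 2) by field.
  rewrite Rpower_Ropp, Rpower_sqrt; auto.
Qed.

Definition legendre (k t : R) : R := 1 / sqrt ((1 - k ^ 2 * t ^ 2) * (1 - t ^ 2)).

Section Legendre.
Context (k c : R) (hc : 0 < c) (hk : k ^ 2 = 1 - c ^ 2).

Lemma continuous_legendre (t : R) : t ^ 2 < 1 -> continuous (legendre k) t.
Proof.
  intros ht. apply (ex_derive_continuous (legendre k)).
  assert (0 < (1 - k ^ 2 * t ^ 2) * (1 - t ^ 2)).
  { apply Rmult_lt_0_compat; [|lra]. rewrite hk.
    assert (0 <= t ^ 2) by apply pow2_ge_0. assert (0 <= c ^ 2) by apply pow2_ge_0. nra. }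
  unfold legendre. auto_derive.
  replace (1 + - (k * (k * 1) * (t * (t * 1)))) with (1 - k ^ 2 * t ^ 2) by ring.
  replace (1 + - (t * (t * 1))) with (1 - t ^ 2) by ring.
  repeat split; auto. apply Rgt_not_eq. now apply sqrt_lt_R0.
Qed.

(** The two factors are the radicands occurring in [subst2] and [subst1]. *)
Lemma quartic_factor (y : R) : quartic c (1 + c ^ 2) y = (1 + c * y ^ 2) * (y ^ 2 + c).
Proof. unfold quartic. ring. Qed.

(* Under these two substitutions the Legendre integrand becomes, up to sign,
   [quartic ^ (-1/2)]:
   the first maps [0, 1] onto [0, 1/sqrt (1 + c)], the second one maps ]0, 1]
   onto the rest of the range of integration, reversing the orientation. *)
Definition subst1 (y : R) : R := y / sqrt (y ^ 2 + c).
Definition subst2 (y : R) : R := 1 / sqrt (1 + c * y ^ 2).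

Lemma subst1_sqr (y : R) : subst1 y ^ 2 = y ^ 2 / (y ^ 2 + c).
Proof.
  unfold subst1. assert (0 <= y ^ 2) by apply pow2_ge_0.
  unfold Rdiv. rewrite Rpow_mult_distr, pow_inv, pow2_sqrt; lra.
Qed.

Lemma subst2_sqr (y : R) : subst2 y ^ 2 = 1 / (1 + c * y ^ 2).
Proof.
  unfold subst2. assert (0 <= c * y ^ 2) by (apply Rmult_le_pos; [lra | apply pow2_ge_0]).
  unfold Rdiv. rewrite Rpow_mult_distr, pow_inv, pow2_sqrt; lra.
Qed.

Lemma is_derive_subst1 (y : R) :
  is_derive subst1 y (c / ((y ^ 2 + c) * sqrt (y ^ 2 + c))).
Proof.
  assert (0 <= y ^ 2) by apply pow2_ge_0.
  assert (hs : 0 < sqrt (y ^ 2 + c)) by (apply sqrt_lt_R0; lra).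
  assert (hs2 : sqrt (y ^ 2 + c) * sqrt (y ^ 2 + c) = y ^ 2 + c) by (apply sqrt_sqrt; lra).
  unfold subst1. auto_derive; replace (y * (y * 1)) with (y ^ 2) by ring.
  - repeat split; lra.
  - set (s := sqrt (y ^ 2 + c)) in *.
    clearbody s. rewrite <- hs2. replace c with (s * s - y * y) by lra. field. lra.
Qed.

Lemma is_derive_subst2 (y : R) :
  is_derive subst2 y (- (c * y) / ((1 + c * y ^ 2) * sqrt (1 + c * y ^ 2))).
Proof.
  assert (0 <= c * y ^ 2) by (apply Rmult_le_pos; [lra | apply pow2_ge_0]).
  assert (hs : 0 < sqrt (1 + c * y ^ 2)) by (apply sqrt_lt_R0; lra).
  assert (hs2 : sqrt (1 + c * y ^ 2) * sqrt (1 + c * y ^ 2) = 1 + c * y ^ 2)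
    by (apply sqrt_sqrt; lra).
  unfold subst2. auto_derive; replace (y * (y * 1)) with (y ^ 2) by ring.
  - repeat split; lra.
  - set (s := sqrt (1 + c * y ^ 2)) in *. clearbody s. rewrite <- hs2. field. lra.
Qed.

(** With t = [subst1 y], 1 - t^2 = c / (y^2 + c) and 1 - k^2 t^2 = c (1 + c y^2) / (y^2 + c). *)
Lemma legendre_subst1 (y : R) :
  c / ((y ^ 2 + c) * sqrt (y ^ 2 + c)) * legendre k (subst1 y)
  = Rpower (quartic c (1 + c ^ 2) y) (-1 / 2).
Proof.
  assert (0 <= y ^ 2) by apply pow2_ge_0.
  assert (0 <= c * y ^ 2) by (apply Rmult_le_pos; lra).
  rewrite Rpower_inv_sqrt by (apply quartic_gt_0; nra).
  rewrite quartic_factor, sqrt_mult by lra.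
  assert (hs : 0 < sqrt (y ^ 2 + c)) by (apply sqrt_lt_R0; lra).
  assert (hs' : 0 < sqrt (1 + c * y ^ 2)) by (apply sqrt_lt_R0; lra).
  unfold legendre. rewrite subst1_sqr, hk.
  replace ((1 - (1 - c ^ 2) * (y ^ 2 / (y ^ 2 + c))) * (1 - y ^ 2 / (y ^ 2 + c)))
    with ((c / (y ^ 2 + c)) ^ 2 * (1 + c * y ^ 2)) by (field; lra).
  assert (0 < c / (y ^ 2 + c)) by (apply Rdiv_lt_0_compat; lra).
  rewrite sqrt_mult, sqrt_pow2 by (try apply pow2_ge_0; lra).
  field. repeat split; lra.
Qed.

(** With t = [subst2 y], 1 - t^2 = c y^2 / (1 + c y^2) and 1 - k^2 t^2 = c (y^2 + c) / (1 + c y^2);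
    the sign of y decides the root of y^2. *)
Lemma legendre_subst2 (y : R) : 0 < y ->
  - (c * y) / ((1 + c * y ^ 2) * sqrt (1 + c * y ^ 2)) * legendre k (subst2 y)
  = - Rpower (quartic c (1 + c ^ 2) y) (-1 / 2).
Proof.
  intros hy.
  assert (0 <= y ^ 2) by apply pow2_ge_0.
  assert (0 <= c * y ^ 2) by (apply Rmult_le_pos; lra).
  rewrite Rpower_inv_sqrt by (apply quartic_gt_0; nra).
  rewrite quartic_factor, sqrt_mult by lra.
  assert (hs : 0 < sqrt (y ^ 2 + c)) by (apply sqrt_lt_R0; lra).
  assert (hs' : 0 < sqrt (1 + c * y ^ 2)) by (apply sqrt_lt_R0; lra).
  unfold legendre. rewrite subst2_sqr, hk.
  replace ((1 - (1 - c ^ 2) * (1 / (1 + c * y ^ 2))) * (1 - 1 / (1 + c * y ^ 2)))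
    with ((c * y / (1 + c * y ^ 2)) ^ 2 * (y ^ 2 + c)) by (field; lra).
  assert (0 < c * y) by (apply Rmult_lt_0_compat; lra).
  assert (0 < c * y / (1 + c * y ^ 2)) by (apply Rdiv_lt_0_compat; lra).
  rewrite sqrt_mult, sqrt_pow2 by (try apply pow2_ge_0; lra).
  field. repeat split; lra.
Qed.

Lemma ex_RInt_legendre (a b : R) : 0 <= a < 1 -> 0 <= b < 1 -> ex_RInt (legendre k) a b.
Proof.
  intros ha hb. apply (ex_RInt_continuous (V := R_CompleteNormedModule)).
  intros t [h1 h2]. apply continuous_legendre.
  assert (0 <= t) by (apply Rle_trans with (2 := h1); apply Rmin_glb; lra).
  assert (t < 1) by (apply Rle_lt_trans with (1 := h2); apply Rmax_lub_lt; lra).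
  nra.
Qed.

Lemma subst1_range (y : R) : 0 <= y -> 0 <= subst1 y < 1.
Proof.
  intros hy. assert (0 <= y ^ 2) by apply pow2_ge_0.
  assert (hs : 0 < sqrt (y ^ 2 + c)) by (apply sqrt_lt_R0; lra).
  assert (0 <= subst1 y) by (apply Rdiv_le_0_compat; lra).
  split; [lra|]. assert (subst1 y ^ 2 < 1); [|nra]. rewrite subst1_sqr.
  apply (Rmult_lt_reg_r (y ^ 2 + c)); [lra|]. unfold Rdiv.
  rewrite Rmult_assoc, Rinv_l; lra.
Qed.

Lemma subst2_range (y : R) : 0 < y -> 0 <= subst2 y < 1.
Proof.
  intros hy. assert (0 < y ^ 2) by (apply pow_lt; lra).
  assert (0 < c * y ^ 2) by (apply Rmult_lt_0_compat; lra).
  assert (hs : 0 < sqrt (1 + c * y ^ 2)) by (apply sqrt_lt_R0; lra).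
  assert (0 <= subst2 y) by (apply Rdiv_le_0_compat; lra).
  split; [lra|]. assert (subst2 y ^ 2 < 1); [|nra]. rewrite subst2_sqr.
  apply (Rmult_lt_reg_r (1 + c * y ^ 2)); [lra|]. unfold Rdiv.
  rewrite Rmult_assoc, Rinv_l; lra.
Qed.

(** The factor 1 keeps [h] convertible to the integrand of [quartic_int] with constant weight. *)
Let h (y : R) : R := 1 * Rpower (quartic c (1 + c ^ 2) y) (-1 / 2).

Lemma continuous_folded (y : R) : continuous h y.
Proof.
  apply (continuous_quartic_Rpower (fun _ => 1)); [exact hc | nra | apply continuous_const].
Qed.

Lemma is_RInt_legendre_subst1 :
  is_RInt (legendre k) 0 (1 / sqrt (1 + c)) (RInt h 0 1).
Proof.
  assert (E0 : subst1 0 = 0) by (unfold subst1; unfold Rdiv; ring).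
  assert (E1 : subst1 1 = 1 / sqrt (1 + c)) by (unfold subst1; now rewrite pow1).
  assert (HI : is_RInt (fun y => scal (c / ((y ^ 2 + c) * sqrt (y ^ 2 + c)))
                                  (legendre k (subst1 y))) 0 1
                 (RInt (legendre k) (subst1 0) (subst1 1))).
  { apply (is_RInt_comp (legendre k) subst1); intros y hy;
      rewrite Rmin_left, Rmax_right in hy by lra.
    - apply continuous_legendre. destruct (subst1_range y); [lra|nra].
    - split; [apply is_derive_subst1|].
      assert (0 <= y ^ 2) by apply pow2_ge_0.
      assert (hs : 0 < sqrt (y ^ 2 + c)) by (apply sqrt_lt_R0; lra).
      apply (ex_derive_continuous (fun y => c / ((y ^ 2 + c) * sqrt (y ^ 2 + c)))).
      auto_derive. replace (y * (y * 1)) with (y ^ 2) by ring.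
      split; [lra|]. split; [|exact I]. apply Rgt_not_eq, Rmult_lt_0_compat; lra. }
  rewrite E0, E1 in HI.
  replace (RInt h 0 1) with (RInt (legendre k) 0 (1 / sqrt (1 + c))).
  - apply (RInt_correct (V := R_CompleteNormedModule)).
    apply ex_RInt_legendre; [lra|]. rewrite <- E1. apply subst1_range; lra.
  - symmetry. apply is_RInt_unique. revert HI. apply is_RInt_ext.
    intros y _. unfold h. rewrite Rmult_1_l. apply legendre_subst1.
Qed.

(** Stopping at y > 0 keeps t = [subst2 y] away from the singular endpoint t = 1, which corresponds
    to y = 0. *)
Lemma is_RInt_legendre_subst2 (y : R) : 0 < y < 1 ->
  is_RInt (legendre k) (1 / sqrt (1 + c)) (subst2 y) (RInt h y 1).
Proof.
  intros hy.
  assert (E1 : subst2 1 = 1 / sqrt (1 + c)) by (unfold subst2; now rewrite pow1, Rmult_1_r).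
  assert (HI : is_RInt (fun y => scal (- (c * y) / ((1 + c * y ^ 2) * sqrt (1 + c * y ^ 2)))
                                  (legendre k (subst2 y))) 1 y
                 (RInt (legendre k) (subst2 1) (subst2 y))).
  { apply (is_RInt_comp (legendre k) subst2); intros x hx;
      rewrite Rmin_right, Rmax_left in hx by lra.
    - apply continuous_legendre. destruct (subst2_range x); [lra|nra].
    - split; [apply is_derive_subst2|].
      assert (0 <= c * x ^ 2) by (apply Rmult_le_pos; [lra | apply pow2_ge_0]).
      assert (hs : 0 < sqrt (1 + c * x ^ 2)) by (apply sqrt_lt_R0; lra).
      apply (ex_derive_continuous (fun x => - (c * x) / ((1 + c * x ^ 2) * sqrt (1 + c * x ^ 2)))).
      auto_derive. replace (x * (x * 1)) with (x ^ 2) by ring.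
      split; [lra|]. split; [|exact I]. apply Rgt_not_eq, Rmult_lt_0_compat; lra. }
  rewrite E1 in HI.
  replace (RInt h y 1) with (RInt (legendre k) (1 / sqrt (1 + c)) (subst2 y)).
  - apply (RInt_correct (V := R_CompleteNormedModule)).
    rewrite <- E1. apply ex_RInt_legendre; apply subst2_range; lra.
  - symmetry. apply is_RInt_unique.
    (* The sign from exchanging the bounds cancels the negative derivative of [subst2]. *)
    apply is_RInt_swap in HI. apply is_RInt_opp in HI.
    rewrite opp_opp in HI. revert HI. apply is_RInt_ext.
    intros x hx. rewrite Rmin_left, Rmax_right in hx by lra.
    unfold h. rewrite Rmult_1_l. change scal with Rmult.
    rewrite legendre_subst2 by lra. apply Ropp_involutive.
Qed.

(** For u close to 1 the integral over [0, u] splits at t0, the common image of y = 1: the first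
    piece is the integral of [h] over [0, 1], the second that over [Y u, 1], which tends to the same
    value as u -> 1. *)
Lemma ellipticK_quartic_int :
  ellipticK k = 2 * quartic_int (fun _ => 1) (-1 / 2) c (1 + c ^ 2).
Proof.
  change (RInt_gen (legendre k) (at_point 0) (at_left 1) = 2 * RInt h 0 1).
  apply is_RInt_gen_unique.
  set (t0 := 1 / sqrt (1 + c)).
  (* [Y] inverts [subst2]: it solves u = 1 / sqrt (1 + c y^2) for y. *)
  set (Y := fun u : R => sqrt ((1 / u ^ 2 - 1) / c)).
  assert (hs : sqrt 1 < sqrt (1 + c)) by (apply sqrt_lt_1; lra).
  rewrite sqrt_1 in hs.
  assert (hs2 : sqrt (1 + c) * sqrt (1 + c) = 1 + c) by (apply sqrt_sqrt; lra).
  assert (ht0 : 0 < t0 < 1).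
  { unfold t0. split; [apply Rdiv_lt_0_compat; lra|].
    apply (Rmult_lt_reg_r (sqrt (1 + c))); [lra|]. unfold Rdiv.
    rewrite Rmult_assoc, Rinv_l; lra. }
  assert (t0_sqr : t0 ^ 2 * (1 + c) = 1).
  { unfold t0. set (s := sqrt (1 + c)) in *. clearbody s. rewrite <- hs2. field. lra. }
  assert (HY : forall u, t0 < u < 1 -> 0 < Y u < 1 /\ subst2 (Y u) = u).
  { intros u hu.
    assert (t0 ^ 2 < u ^ 2 < 1) by nra.
    assert (0 < 1 / u ^ 2 - 1).
    { apply (Rmult_lt_reg_r (u ^ 2)); [nra|].
      replace ((1 / u ^ 2 - 1) * u ^ 2) with (1 - u ^ 2) by (field; lra). lra. }
    assert (1 / u ^ 2 - 1 < c).
    { apply (Rmult_lt_reg_r (u ^ 2)); [nra|].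
      replace ((1 / u ^ 2 - 1) * u ^ 2) with (1 - u ^ 2) by (field; lra). nra. }
    assert (0 < (1 / u ^ 2 - 1) / c) by (apply Rdiv_lt_0_compat; lra).
    split; [split|].
    - now apply sqrt_lt_R0.
    - apply Rlt_le_trans with (sqrt 1); [apply sqrt_lt_1; try lra | rewrite sqrt_1; lra].
      apply (Rmult_lt_reg_r c); [lra|]. unfold Rdiv. rewrite Rmult_assoc, Rinv_l; lra.
    - unfold subst2, Y. rewrite pow2_sqrt by lra.
      replace (1 + c * ((1 / u ^ 2 - 1) / c)) with ((/ u) ^ 2) by (field; lra).
      rewrite sqrt_pow2 by (apply Rlt_le, Rinv_0_lt_compat; lra). field. lra. }
  intros Q HQ.
  (* The two sets witness the product filter: lower bound exactly 0, upper bound in a left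
     neighbourhood of 1. *)
  exists (fun x => x = 0) (fun u => t0 < u < 1 /\ Q (RInt h 0 1 + RInt h (Y u) 1)).
  - reflexivity.
  (* Unlike the Legendre integrand, this expression is regular at u = 1, so the limit is its value
     there, with Y 1 = 0. *)
  - assert (HC : continuous (fun u => RInt h 0 1 + RInt h (Y u) 1) 1).
    { apply (continuous_plus (fun _ : R => RInt h 0 1)); [apply continuous_const|].
      apply (continuous_comp Y (fun y => RInt h y 1)).
      - apply (continuous_comp (fun u => (1 / u ^ 2 - 1) / c) sqrt).
        + apply (ex_derive_continuous (fun u => (1 / u ^ 2 - 1) / c)).
          auto_derive. lra.
        + apply continuous_sqrt.
      - apply (continuous_RInt_2 (V := R_NormedModule) h _ 1 (fun y => RInt h y 1)).
        apply filter_forall. intros y.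
        apply (RInt_correct (V := R_CompleteNormedModule)).
        apply (ex_RInt_continuous (V := R_CompleteNormedModule)).
        intros; apply continuous_folded. }
    assert (Y1 : Y 1 = 0).
    { unfold Y. replace ((1 / 1 ^ 2 - 1) / c) with 0 by (field; lra). apply sqrt_0. }
    assert (HL : locally 1 (fun u => Q (RInt h 0 1 + RInt h (Y u) 1))).
    { apply HC. rewrite Y1. now replace (RInt h 0 1 + RInt h 0 1) with (2 * RInt h 0 1) by ring. }
    apply filter_and.
    + unfold at_left, within. apply (filter_imp (fun u => t0 < u)).
      * intros u h1 h2. now split.
      * apply open_gt. lra.
    + unfold at_left, within. revert HL. apply filter_imp. now intros u Hu _.
  - intros x u -> [hu HQu]. exists (RInt h 0 1 + RInt h (Y u) 1). split; [|exact HQu].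
    simpl. destruct (HY u hu) as [hY Eu].
    apply (is_RInt_Chasles (V := R_NormedModule)) with t0.
    + apply is_RInt_legendre_subst1.
    + rewrite <- Eu at 1. now apply is_RInt_legendre_subst2.
Qed.
End Legendre.

Lemma Cn_sqrt (D : R -> Prop) (open_D : open D) (n : nat) (f : R -> R) :
  (forall x, D x -> 0 < f x) -> Cn D n f -> Cn D n (fun x => sqrt (f x)).
Proof.
  intros pos Hf. apply (Cn_ext D open_D n (fun x => Rpower (f x) (/ 2))).
  - intros x hx. apply Rpower_sqrt. auto.
  - now apply Cn_Rpower.
Qed.

(** * Scaling, monotonicity and a closed form of the quartic integral *)

Lemma quartic_int_scal (w : R -> R) (q c S P : R) :
  0 < c -> 0 < S -> 0 < P -> (forall y, continuous w y) ->
  quartic_int w q (c * S) (c * P) = Rpower c q * quartic_int w q S P.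
Proof.
  intros hc hS hP Hw. unfold quartic_int.
  rewrite <- (RInt_scal (V := R_CompleteNormedModule) _ 0 1 (Rpower c q))
    by now apply ex_RInt_quartic.
  apply RInt_ext. intros y _. change scal with Rmult.
  replace (quartic (c * S) (c * P) y) with (c * quartic S P y) by (unfold quartic; ring).
  rewrite <- Rpower_mult_distr by (auto; now apply quartic_gt_0).
  match goal with |- ?a = ?b => change (a = b :> R) end. ring.
Qed.

Lemma quartic_int_lt (S1 P1 S2 P2 : R) : 0 < S1 < S2 -> 0 < P1 < P2 ->
  quartic_int (fun _ => 1) (-1 / 2) S2 P2 < quartic_int (fun _ => 1) (-1 / 2) S1 P1.
Proof.
  intros hS hP. apply RInt_lt; [lra| | |].
  - intros y _. apply (continuous_quartic_Rpower (fun _ => 1)); try lra. apply continuous_const.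
  - intros y _. apply (continuous_quartic_Rpower (fun _ => 1)); try lra. apply continuous_const.
  - intros y hy. rewrite !Rmult_1_l, !Rpower_inv_sqrt by (apply quartic_gt_0; lra).
    assert (H1 : 0 < quartic S1 P1 y) by (apply quartic_gt_0; lra).
    assert (H2 : quartic S1 P1 y < quartic S2 P2 y).
    { unfold quartic. assert (0 < y ^ 2) by (apply pow_lt; lra).
      assert (0 < y ^ 4) by (apply pow_lt; lra). nra. }
    apply Rinv_lt_contravar.
    + apply Rmult_lt_0_compat; apply sqrt_lt_R0; lra.
    + apply sqrt_lt_1; lra.
Qed.

(** This is the case a = b: the quartic is A (1 + y^2)^2 and the integrand has primitive atan y /
    sqrt A. *)
Lemma quartic_int_square (A : R) : 0 < A ->
  quartic_int (fun _ => 1) (-1 / 2) A (2 * A) = PI / 4 / sqrt A.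
Proof.
  intros hA. apply is_RInt_unique.
  assert (hs : 0 < sqrt A) by now apply sqrt_lt_R0.
  replace (PI / 4 / sqrt A) with (minus (/ sqrt A * atan 1) (/ sqrt A * atan 0))
    by (rewrite atan_1, atan_0; unfold minus, plus, opp; simpl; field; lra).
  apply (is_RInt_ext (fun y => / sqrt A * / (1 + y ^ 2))).
  { intros y _. assert (0 <= y ^ 2) by apply pow2_ge_0.
    rewrite Rmult_1_l, Rpower_inv_sqrt by (apply quartic_gt_0; lra).
    replace (quartic A (2 * A) y) with (A * (1 + y ^ 2) ^ 2) by (unfold quartic; ring).
    rewrite sqrt_mult, sqrt_pow2 by (try apply pow2_ge_0; lra).
    rewrite Rinv_mult. reflexivity. }
  apply (is_RInt_derive (V := R_CompleteNormedModule) (fun y => / sqrt A * atan y)).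
  - intros y _. apply (is_derive_scal atan). apply is_derive_Reals.
    apply derivable_pt_lim_atan.
  - intros y _. assert (0 <= y ^ 2) by apply pow2_ge_0.
    apply (ex_derive_continuous (fun y => / sqrt A * / (1 + y ^ 2))).
    auto_derive. lra.
Qed.

(** * The roots of the cubic, and the period as a function of their sum sigma *)

Section Period.
Context (r s : R) (hr : 0 < r) (hs : 0 < s).

(* The cubic [- X^3/3 - X^2/2 + r X + s B] (with [X = phi^2]) whose energy level [B] is that
   of [alpha] has the roots [alpha], [p = sigma - alpha] and [- g = - (sigma + 3/2)]. *)
Definition sigma (alpha : R) : R :=
  (sqrt (9 + 48 * r - 12 * alpha - 12 * alpha ^ 2) + 2 * alpha - 3) / 4.

(* With [a^2 = alpha (p + g)] and [b^2 = p (alpha + g)], these are [ab] and [a^2 + b^2]. *)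
Definition prod_sigma (x : R) : R :=
  sqrt ((x ^ 2 + 3 / 2 * x - 3 * r) * (3 * x ^ 2 + 6 * x + 9 / 4 - 3 * r)).
Definition sum_sigma (x : R) : R := 3 * x ^ 2 + 9 / 2 * x - 6 * r.

(** The lower end of [I3]: the critical point of the energy, where alpha = p is a double root. *)
Definition alpha_min : R := (-1 + sqrt (1 + 4 * r)) / 2.

Lemma alpha_min_spec : 0 < alpha_min /\ alpha_min ^ 2 + alpha_min = r.
Proof.
  unfold alpha_min.
  assert (sqrt 1 < sqrt (1 + 4 * r)) by (apply sqrt_lt_1; lra). rewrite sqrt_1 in *.
  assert (sqrt (1 + 4 * r) * sqrt (1 + 4 * r) = 1 + 4 * r) by (apply sqrt_sqrt; lra).
  split; [lra|]. nra.
Qed.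

(** Polynomial forms of the two ends of [I3]: alpha lies beyond the critical point of the energy,
    and its energy alpha (2 alpha^2 + 3 alpha - 6 r) / (6 s) is negative. *)
Lemma I3_spec (alpha : R) : I3 r alpha ->
  alpha_min < alpha /\ r < alpha ^ 2 + alpha /\ 2 * alpha ^ 2 + 3 * alpha < 6 * r.
Proof.
  intros [h1 h2]. fold alpha_min in h1. destruct alpha_min_spec as [l0 l1].
  assert (0 <= sqrt (9 + 48 * r)) by apply sqrt_pos.
  assert (sqrt (9 + 48 * r) * sqrt (9 + 48 * r) = 9 + 48 * r) by (apply sqrt_sqrt; lra).
  split; [exact h1|]. split; nra.
Qed.

Section Alpha.
Context (alpha : R) (halpha : I3 r alpha).
(** Dividing the cubic by X - alpha leaves a quadratic with roots p = (v - 2 alpha - 3) / 4 and - g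
    = - (v + 2 alpha + 3) / 4; thus v = 2 (p + g). *)
Let v := sqrt (9 + 48 * r - 12 * alpha - 12 * alpha ^ 2).

(** The bounds on v say that 0 < p < alpha. *)
Lemma root_spec :
  0 < alpha /\ v * v = 9 + 48 * r - 12 * alpha - 12 * alpha ^ 2 /\
  2 * alpha + 3 < v < 6 * alpha + 3.
Proof.
  destruct (I3_spec alpha halpha) as [h0 [h1 h2]]. destruct alpha_min_spec as [l0 _].
  assert (E : v * v = 9 + 48 * r - 12 * alpha - 12 * alpha ^ 2) by (apply sqrt_sqrt; nra).
  assert (0 <= v) by apply sqrt_pos.
  repeat split; [lra | exact E | nra | nra].
Qed.

(** The quadratic expression equals alpha p by Vieta. The upper bound on sigma is (alpha - p)^2 > 0
    rewritten: sigma^2 + 2 sigma < 4 r, with equality at 2 [alpha_min]. *)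
Lemma sigma_spec :
  0 < sigma alpha < 2 * alpha_min /\
  0 < sigma alpha ^ 2 + 3 / 2 * sigma alpha - 3 * r.
Proof.
  destruct (I3_spec alpha halpha) as [h0 [h1 h2]]. destruct alpha_min_spec as [l0 l1].
  destruct root_spec as [h3 [E [h4 h5]]].
  assert (Es : sigma alpha = (v + 2 * alpha - 3) / 4) by reflexivity.
  set (x := sigma alpha) in *. clearbody x v.
  assert (Ev : v = 4 * x - 2 * alpha + 3) by lra.
  assert (Ep : x ^ 2 + 3 / 2 * x - 3 * r = alpha * (x - alpha)) by (subst v; nra).
  assert (0 < alpha * (x - alpha)) by (apply Rmult_lt_0_compat; lra).
  assert (0 < (2 * alpha - x) * (2 * alpha - x)) by (apply Rmult_lt_0_compat; lra).
  split; [split; nra|lra].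
Qed.

Lemma sum_sigma_gt_0 : 0 < sum_sigma (sigma alpha).
Proof. destruct sigma_spec as [h1 h2]. unfold sum_sigma. nra. Qed.

(** The factors are alpha p and (p + g) (alpha + g), whose product is a^2 b^2. *)
Lemma prod_sigma_arg_gt_0 : 0 < (sigma alpha ^ 2 + 3 / 2 * sigma alpha - 3 * r)
  * (3 * sigma alpha ^ 2 + 6 * sigma alpha + 9 / 4 - 3 * r).
Proof. destruct sigma_spec as [h1 h2]. apply Rmult_lt_0_compat; nra. Qed.

Lemma prod_sigma_gt_0 : 0 < prod_sigma (sigma alpha).
Proof. apply sqrt_lt_R0, prod_sigma_arg_gt_0. Qed.

Lemma is_derive_sigma :
  is_derive sigma alpha ((v - 3 * (2 * alpha + 1)) / (2 * v)).
Proof.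
  destruct root_spec as [h3 [E [h4 h5]]].
  unfold sigma. auto_derive;
    replace (9 + 48 * r + - (12 * alpha) + - (12 * (alpha * (alpha * 1))))
    with (9 + 48 * r - 12 * alpha - 12 * alpha ^ 2) by ring.
  - nra.
  - fold v. field. lra.
Qed.

(** With c = b / a the coefficients are ab = a^2 c and a^2 + b^2 = a^2 (1 + c^2), so pulling out a^2
    leaves the quartic integral that represents [ellipticK]. *)
Lemma period_alpha_quartic_int :
  period_alpha r s alpha
  = 4 * sqrt (3 * s) * quartic_int (fun _ => 1) (-1 / 2)
                         (prod_sigma (sigma alpha)) (sum_sigma (sigma alpha)).
Proof.
  destruct root_spec as [h3 [E [h4 h5]]].
  pose proof sigma_spec as [hx1 hx2].
  assert (s3 : 0 < sqrt 3) by (apply sqrt_lt_R0; lra).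
  assert (s33 : sqrt 3 * sqrt 3 = 3) by (apply sqrt_sqrt; lra).
  assert (hb : 0 < beta r alpha) by (unfold beta; nra).
  assert (Ev : v = sqrt 3 * sqrt (beta r alpha)).
  { rewrite <- sqrt_mult by lra. unfold v, beta. f_equal. ring. }
  assert (hw : 0 < sqrt (beta r alpha)) by now apply sqrt_lt_R0.
  assert (Es : sigma alpha = (v + 2 * alpha - 3) / 4) by reflexivity.
  (* a^2 = alpha (p + g) and b^2 = p (alpha + g), with p and g expressed through v. *)
  set (a2 := alpha * v / 2).
  set (b2 := (alpha * v - 6 * alpha ^ 2 - 9 * alpha + 12 * r) / 4).
  assert (ha2 : 0 < a2) by (unfold a2; nra).
  assert (Eprod : a2 * b2 = (sigma alpha ^ 2 + 3 / 2 * sigma alpha - 3 * r)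
    * (3 * sigma alpha ^ 2 + 6 * sigma alpha + 9 / 4 - 3 * r)).
  { rewrite Es. unfold a2, b2.
    replace r with ((v * v - 9 + 12 * alpha + 12 * alpha ^ 2) / 48) by lra. field. }
  assert (Esum : a2 + b2 = sum_sigma (sigma alpha)).
  { rewrite Es. unfold a2, b2, sum_sigma.
    replace r with ((v * v - 9 + 12 * alpha + 12 * alpha ^ 2) / 48) by lra. field. }
  assert (hb2 : 0 < b2).
  { apply (Rmult_lt_reg_l a2); [exact ha2|]. rewrite Rmult_0_r, Eprod.
    apply prod_sigma_arg_gt_0. }
  (* The difference is g (alpha - p); its sign lets squaring undo the root in [modulus]. *)
  assert (hab : b2 <= a2).
  { unfold a2, b2. nra. }
  set (c := sqrt (b2 / a2)).
  assert (hc : 0 < c) by (apply sqrt_lt_R0; now apply Rdiv_lt_0_compat).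
  assert (hc2 : c ^ 2 = b2 / a2) by (apply pow2_sqrt; apply Rlt_le; now apply Rdiv_lt_0_compat).
  assert (hk : modulus r alpha ^ 2 = 1 - c ^ 2).
  { unfold modulus.
    replace ((6 * alpha ^ 2 + 9 * alpha - 12 * r + alpha * sqrt 3 * sqrt (beta r alpha))
             / (2 * sqrt 3 * alpha * sqrt (beta r alpha))) with ((a2 - b2) / a2).
    - rewrite pow2_sqrt; [rewrite hc2; field; lra|].
      apply Rdiv_le_0_compat; lra.
    - unfold a2, b2. rewrite Ev. field. repeat split; lra. }
  assert (E1 : prod_sigma (sigma alpha) = a2 * c).
  { unfold prod_sigma. rewrite <- Eprod.
    replace (a2 * b2) with (a2 ^ 2 * (b2 / a2)) by (field; lra).
    rewrite sqrt_mult, sqrt_pow2; try lra; try apply pow2_ge_0. reflexivity.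
    rewrite <- hc2. apply pow2_ge_0. }
  assert (E2 : sum_sigma (sigma alpha) = a2 * (1 + c ^ 2)).
  { rewrite <- Esum, hc2. field. lra. }
  rewrite E1, E2, quartic_int_scal; [|lra|lra|nra|intros; apply continuous_const].
  unfold period_alpha. rewrite (ellipticK_quartic_int _ c hc hk).
  rewrite Rpower_inv_sqrt by lra.
  assert (hA : 0 < alpha * sqrt (beta r alpha)) by (apply Rmult_lt_0_compat; lra).
  assert (hsA : 0 < sqrt (alpha * sqrt (beta r alpha))) by now apply sqrt_lt_R0.
  assert (hsa : 0 < sqrt a2) by now apply sqrt_lt_R0.
  (* The prefactors match because a^2 = alpha sqrt 3 sqrt beta / 2. *)
  assert (key : sqrt (2 * sqrt 3 * s) * sqrt a2 = sqrt (3 * s) * sqrt (alpha * sqrt (beta r alpha))).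
  { assert (0 < sqrt 3 * s) by (apply Rmult_lt_0_compat; lra).
    rewrite <- !sqrt_mult by lra. f_equal. unfold a2. rewrite Ev.
    rewrite <- s33 at 3. field. }
  set (Q := quartic_int _ _ _ _).
  apply (Rmult_eq_reg_r (sqrt a2 * sqrt (alpha * sqrt (beta r alpha)))).
  2: apply Rgt_not_eq; now apply Rmult_lt_0_compat.
  transitivity (4 * Q * (sqrt (2 * sqrt 3 * s) * sqrt a2)); [field; lra|].
  rewrite key. field. lra.
Qed.
End Alpha.
End Period.

(** * The inverse of the energy and its smoothness *)

Section Energy.
Context (r s : R) (hr : 0 < r) (hs : 0 < s).

(** The divided difference of s times the energy; on the diagonal it is the derivative a^2 + a -
    r. *)
Definition energy_slope (a b : R) : R := (a ^ 2 + a * b + b ^ 2) / 3 + (a + b) / 2 - r.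

Lemma energy_sub (a b : R) :
  energy r s a - energy r s b = (a - b) * energy_slope a b / s.
Proof. unfold energy, energy_slope. field. lra. Qed.

(** The slope vanishes when both arguments are [alpha_min] and increases in each of them from
    there. *)
Lemma energy_slope_gt_0 (a b : R) : alpha_min r <= a -> alpha_min r < b -> 0 < energy_slope a b.
Proof.
  intros ha hb. destruct (alpha_min_spec r hr) as [l0 l1]. unfold energy_slope. nra.
Qed.

Lemma energy_inj (a b : R) : I3 r a -> I3 r b -> energy r s a = energy r s b -> a = b.
Proof.
  intros ha hb E.
  apply (I3_spec r hr) in ha. apply (I3_spec r hr) in hb.
  assert (h : 0 < energy_slope a b / s).
  { apply Rdiv_lt_0_compat; [apply energy_slope_gt_0; lra | exact hs]. }
  pose proof (energy_sub a b) as Es. rewrite E in Es.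
  assert (h0 : (a - b) * (energy_slope a b / s) = 0) by (unfold Rdiv in *; lra).
  apply Rmult_integral in h0. lra.
Qed.

Lemma alpha_of_energy_spec (B : R) : energy r s (alpha_min r) < B < 0 ->
  I3 r (alpha_of_energy r s B) /\ energy r s (alpha_of_energy r s B) = B.
Proof.
  intros hB.
  set (u := (-3 + sqrt (9 + 48 * r)) / 4).
  destruct (alpha_min_spec r hr) as [l0 l1].
  assert (q0 : 0 <= sqrt (9 + 48 * r)) by apply sqrt_pos.
  assert (q1 : sqrt (9 + 48 * r) * sqrt (9 + 48 * r) = 9 + 48 * r) by (apply sqrt_sqrt; lra).
  assert (hu : 2 * u ^ 2 + 3 * u = 6 * r) by (unfold u; nra).
  assert (u0 : 0 < u) by (unfold u; nra).
  assert (hlu : alpha_min r < u) by nra.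
  assert (Eu : energy r s u = 0).
  (* The upper end of [I3] is the positive zero of the energy, so B lies strictly between the values
     at the two ends. *)
  { unfold energy. replace r with ((2 * u ^ 2 + 3 * u) / 6) by lra. field. lra. }
  destruct (IVT (fun a => energy r s a - B) (alpha_min r) u) as [a [ha Ea]]; try lra.
  - unfold energy. intros x. apply continuity_pt_filterlim.
    apply (ex_derive_continuous (fun a => 1 / s * (a ^ 3 / 3 + a ^ 2 / 2 - r * a) - B)).
    now auto_derive.
  - apply (iota_correct (fun a : R => I3 r a /\ energy r s a = B)). exists a. split.
    + assert (a <> alpha_min r) by (intros ->; lra).
      assert (a <> u) by (intros ->; lra).
      split; [|lra]. unfold I3. fold u. fold (alpha_min r). lra.
    + intros b [hb Eb]. apply energy_inj; [|exact hb|lra].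
      assert (a <> alpha_min r) by (intros ->; lra).
      assert (a <> u) by (intros ->; lra).
      unfold I3. fold u. fold (alpha_min r). lra.
Qed.

Let D (B : R) : Prop := energy r s (alpha_min r) < B < 0.
Let alpha (B : R) : R := alpha_of_energy r s B.

Lemma open_energy_range : open D.
Proof. apply open_and; [apply open_gt | apply open_lt]. Qed.

(** An exact difference quotient for the inverse function, from which continuity and then the
    derivative follow. *)
Lemma alpha_sub (B1 B2 : R) : D B1 -> D B2 ->
  alpha B1 - alpha B2 = s * (B1 - B2) / energy_slope (alpha B1) (alpha B2).
Proof.
  intros h1 h2.
  destruct (alpha_of_energy_spec B1 h1) as [i1 e1]. fold (alpha B1) in *.
  destruct (alpha_of_energy_spec B2 h2) as [i2 e2]. fold (alpha B2) in *.
  apply (I3_spec r hr) in i1. apply (I3_spec r hr) in i2.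
  assert (h : 0 < energy_slope (alpha B1) (alpha B2)) by (apply energy_slope_gt_0; lra).
  rewrite <- e1 at 2. rewrite <- e2 at 2. rewrite energy_sub. field. lra.
Qed.

Lemma continuous_alpha (B : R) : D B -> continuous alpha B.
Proof.
  intros hB.
  destruct (alpha_of_energy_spec B hB) as [i e]. fold (alpha B) in *.
  apply (I3_spec r hr) in i. destruct (alpha_min_spec r hr) as [l0 l1].
  (* m bounds the slopes from [alpha B] to every other [alpha B'] from below, which gives a
     Lipschitz estimate at B with constant s / m. *)
  set (m := energy_slope (alpha_min r) (alpha B)).
  assert (hm : 0 < m) by (apply energy_slope_gt_0; lra).
  apply (proj2 (filterlim_locally alpha (alpha B))). intros eps.
  assert (he : 0 < eps * m / s).
  { apply Rdiv_lt_0_compat; [|exact hs]. apply Rmult_lt_0_compat; [apply cond_pos | exact hm]. }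
  destruct (open_energy_range B hB) as [d1 Hd1].
  assert (hd : 0 < Rmin d1 (eps * m / s)) by (apply Rmin_glb_lt; [apply cond_pos | exact he]).
  exists (mkposreal _ hd). intros B' hB'.
  change (Rabs (B' - B) < Rmin d1 (eps * m / s)) in hB'.
  assert (hD' : D B').
  { apply Hd1. apply Rlt_le_trans with (1 := hB'), Rmin_l. }
  change (Rabs (alpha B' - alpha B) < eps).
  destruct (alpha_of_energy_spec B' hD') as [i' e']. fold (alpha B') in *.
  apply (I3_spec r hr) in i'.
  assert (hg : m <= energy_slope (alpha B') (alpha B)) by (unfold m, energy_slope; nra).
  rewrite alpha_sub by auto. unfold Rdiv. rewrite !Rabs_mult.
  rewrite (Rabs_right s) by lra.
  rewrite (Rabs_right (/ _)) by (apply Rle_ge, Rlt_le, Rinv_0_lt_compat; lra).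
  apply Rle_lt_trans with (s * Rabs (B' - B) * / m).
  - apply Rmult_le_compat_l; [apply Rmult_le_pos; [lra | apply Rabs_pos]|].
    now apply Rinv_le_contravar.
  - apply (Rmult_lt_reg_r (m / s)); [now apply Rdiv_lt_0_compat|].
    replace (s * Rabs (B' - B) * / m * (m / s)) with (Rabs (B' - B)) by (field; lra).
    apply Rlt_le_trans with (1 := hB').
    apply Rle_trans with (1 := Rmin_r _ _). right. field. lra.
Qed.

(** By [alpha_sub] the difference quotient is s over a slope, and by continuity of [alpha] this
    slope tends to the diagonal one. *)
Lemma is_derive_alpha (B : R) : D B ->
  is_derive alpha B (s / energy_slope (alpha B) (alpha B)).
Proof.
  intros hB.
  destruct (alpha_of_energy_spec B hB) as [i e]. fold (alpha B) in *.
  apply (I3_spec r hr) in i.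
  assert (hg : 0 < energy_slope (alpha B) (alpha B)) by (apply energy_slope_gt_0; lra).
  assert (HC : continuous (fun B' => s / energy_slope (alpha B') (alpha B)) B).
  { apply (continuous_comp alpha (fun a => s / energy_slope a (alpha B))).
    - now apply continuous_alpha.
    - apply (ex_derive_continuous (fun a => s / energy_slope a (alpha B))).
      unfold energy_slope in *. auto_derive. apply Rgt_not_eq.
      eapply Rlt_le_trans; [exact hg | right; field]. }
  apply is_derive_Reals. intros eps he.
  destruct (proj1 (filterlim_locally _ _) HC (mkposreal eps he)) as [d1 H1].
  destruct (open_energy_range B hB) as [d2 H2].
  assert (hd : 0 < Rmin d1 d2) by (apply Rmin_glb_lt; apply cond_pos).
  exists (mkposreal _ hd). intros h hn hh. simpl in hh.
  assert (Eh : B + h - B = h) by ring.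
  assert (hD' : D (B + h)).
  { apply H2. change (Rabs (B + h - B) < d2). rewrite Eh.
    apply Rlt_le_trans with (1 := hh), Rmin_r. }
  assert (hb : ball B d1 (B + h)).
  { change (Rabs (B + h - B) < d1). rewrite Eh.
    apply Rlt_le_trans with (1 := hh), Rmin_l. }
  specialize (H1 _ hb).
  destruct (alpha_of_energy_spec (B + h) hD') as [i' e']. fold (alpha (B + h)) in *.
  apply (I3_spec r hr) in i'.
  assert (hg' : 0 < energy_slope (alpha (B + h)) (alpha B)) by (apply energy_slope_gt_0; lra).
  rewrite alpha_sub by auto. rewrite Eh.
  replace (s * h / energy_slope (alpha (B + h)) (alpha B) / h)
    with (s / energy_slope (alpha (B + h)) (alpha B)) by (field; lra).
  exact H1.
Qed.

(** Bootstrapping: alpha' = s / (alpha^2 + alpha - r) is a smooth expression in alpha, so each order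
    yields the next. The reciprocal is written as a power to fall under [Cn_Rpower]. *)
Lemma Cn_alpha (n : nat) : Cn D n alpha.
Proof.
  induction n as [|n IH]; [exact continuous_alpha|].
  exists (fun B => s * Rpower (alpha B * alpha B + alpha B + - r) (- (1))).
  assert (pos : forall B, D B -> 0 < alpha B * alpha B + alpha B + - r).
  { intros B hB. destruct (alpha_of_energy_spec B hB) as [i _]. fold (alpha B) in *.
    apply (I3_spec r hr) in i. nra. }
  split.
  - intros B hB. rewrite Rpower_Ropp, Rpower_1 by now apply pos.
    replace (alpha B * alpha B + alpha B + - r) with (energy_slope (alpha B) (alpha B))
      by (unfold energy_slope; field).
    now apply is_derive_alpha.
  - apply Cn_mult; [apply Cn_const|]. apply Cn_Rpower; [exact pos|].
    apply Cn_plus; [|apply Cn_const]. apply Cn_plus; [|exact IH]. now apply Cn_mult.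
Qed.

(** * The period as a function of B: smoothness, sign of the derivative, lower bound *)

Let x (B : R) : R := sigma r (alpha B).

Lemma alpha_I3 (B : R) : D B -> I3 r (alpha B).
Proof. intros hB. now destruct (alpha_of_energy_spec B hB). Qed.

Lemma Cn_sigma_alpha (n : nat) : Cn D n x.
Proof.
  apply (Cn_ext D open_energy_range n (fun B => / 4 * (sqrt (9 + 48 * r + - 12 * alpha B
           + - 12 * (alpha B * alpha B)) + 2 * alpha B + - 3))).
  { intros B _. unfold x, sigma.
    replace (9 + 48 * r + - 12 * alpha B + - 12 * (alpha B * alpha B))
      with (9 + 48 * r - 12 * alpha B - 12 * alpha B ^ 2) by ring. field. }
  pose proof (Cn_alpha n).
  apply Cn_mult; [apply Cn_const|].
  apply Cn_plus; [|apply Cn_const].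
  apply Cn_plus; [|apply Cn_mult; [apply Cn_const | auto]].
  apply Cn_sqrt; [exact open_energy_range| |].
  - intros B hB. destruct (root_spec r hr (alpha B) (alpha_I3 B hB)) as [h1 [h2 h3]]. nra.
  - apply Cn_plus; [|apply Cn_mult; [apply Cn_const | now apply Cn_mult]].
    apply Cn_plus; [apply Cn_const | apply Cn_mult; [apply Cn_const | auto]].
Qed.

Lemma Cn_prod_sigma (n : nat) : Cn D n (fun B => prod_sigma r (x B)).
Proof.
  apply Cn_sqrt; [exact open_energy_range| |].
  - intros B hB. exact (prod_sigma_arg_gt_0 r hr (alpha B) (alpha_I3 B hB)).
  - pose proof (Cn_sigma_alpha n) as H.
    apply (Cn_ext D open_energy_range n (fun B => (x B * x B + 3 / 2 * x B + - (3 * r))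
                          * (3 * (x B * x B) + 6 * x B + (9 / 4 - 3 * r)))).
    { intros B _. ring. }
    apply Cn_mult; (apply Cn_plus; [|apply Cn_const]);
      (apply Cn_plus; [|apply Cn_mult; [apply Cn_const|exact H]]).
    + now apply Cn_mult.
    + apply Cn_mult; [apply Cn_const | now apply Cn_mult].
Qed.

Lemma Cn_sum_sigma (n : nat) : Cn D n (fun B => sum_sigma r (x B)).
Proof.
  pose proof (Cn_sigma_alpha n) as H.
  apply (Cn_ext D open_energy_range n (fun B => 3 * (x B * x B) + 9 / 2 * x B + - (6 * r))).
  { intros B _. unfold sum_sigma. ring. }
  apply Cn_plus; [|apply Cn_const].
  apply Cn_plus; apply Cn_mult; try apply Cn_const; auto. now apply Cn_mult.
Qed.

Lemma period_quartic_int (B : R) : D B -> period r s B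
  = 4 * sqrt (3 * s) * quartic_int (fun _ => 1) (-1 / 2) (prod_sigma r (x B)) (sum_sigma r (x B)).
Proof.
  intros hB. apply (period_alpha_quartic_int r s hr hs (alpha B)). now apply alpha_I3.
Qed.

Lemma Cn_period (n : nat) : Cn D n (period r s).
Proof.
  apply (Cn_ext D open_energy_range n (fun B => 4 * sqrt (3 * s) *
    quartic_int (fun _ => 1) (-1 / 2) (prod_sigma r (x B)) (sum_sigma r (x B)))).
  { intros B hB. symmetry. now apply period_quartic_int. }
  apply Cn_mult; [apply Cn_const|].
  apply Cn_quartic_int; [exact open_energy_range| | | | exact Cn_prod_sigma | exact Cn_sum_sigma].
  - intros; apply continuous_const.
  - intros B hB. exact (prod_sigma_gt_0 r hr (alpha B) (alpha_I3 B hB)).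
  - intros B hB. exact (sum_sigma_gt_0 r hr (alpha B) (alpha_I3 B hB)).
Qed.

(** alpha increases with B, and sigma has negative derivative in alpha because v < 6 alpha + 3, that
    is, p < alpha. *)
Lemma sigma_alpha_derive_neg (B : R) : D B -> exists x', is_derive x B x' /\ x' < 0.
Proof.
  intros hB. pose proof (alpha_I3 B hB) as i.
  destruct (root_spec r hr (alpha B) i) as [h1 [h2 h3]].
  set (v := sqrt (9 + 48 * r - 12 * alpha B - 12 * alpha B ^ 2)) in *.
  exists (s / energy_slope (alpha B) (alpha B) * ((v - 3 * (2 * alpha B + 1)) / (2 * v))).
  split.
  - apply (is_derive_comp (sigma r) alpha); [now apply is_derive_sigma | now apply is_derive_alpha].
  - apply (I3_spec r hr) in i.
    assert (0 < s / energy_slope (alpha B) (alpha B)).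
    { apply Rdiv_lt_0_compat; [exact hs | apply energy_slope_gt_0; lra]. }
    assert (0 < (3 * (2 * alpha B + 1) - v) / (2 * v)) by (apply Rdiv_lt_0_compat; lra).
    replace ((v - 3 * (2 * alpha B + 1)) / (2 * v))
      with (- ((3 * (2 * alpha B + 1) - v) / (2 * v))) by (field; lra). nra.
Qed.

(** Both coefficients of the quartic decrease in B, and the exponent -1/2 turns this into a positive
    derivative of the integrand at each y in (0, 1). *)
Lemma Derive_period_gt_0 (B : R) : D B -> 0 < Derive (period r s) B.
Proof.
  intros hB.
  destruct (Cn_prod_sigma 1) as [S' [HS CS]]. destruct (Cn_sum_sigma 1) as [P' [HP CP]].
  pose proof (alpha_I3 B hB) as i.
  destruct (sigma_alpha_derive_neg B hB) as [x' [Hx hx']].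
  destruct (sigma_spec r hr (alpha B) i) as [hx0 hx1]. fold (x B) in *.
  pose proof (prod_sigma_arg_gt_0 r hr (alpha B) i) as hQ. fold (x B) in *.
  assert (hP' : P' B < 0).
  { replace (P' B) with (x' * (6 * x B + 9 / 2)); [nra|].
    rewrite <- (is_derive_unique _ _ _ (HP B hB)). symmetry. apply is_derive_unique.
    apply (is_derive_comp (sum_sigma r) x); [|exact Hx].
    unfold sum_sigma. auto_derive; [exact I | ring]. }
  assert (hS' : S' B < 0).
  { set (q := sqrt ((x B ^ 2 + 3 / 2 * x B - 3 * r)
                    * (3 * x B ^ 2 + 6 * x B + 9 / 4 - 3 * r))).
    assert (hq : 0 < q) by now apply sqrt_lt_R0.
    (* N is the derivative in sigma of the radicand a^2 b^2 of [prod_sigma]. *)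
    set (N := (2 * x B + 3 / 2) * (3 * x B ^ 2 + 6 * x B + 9 / 4 - 3 * r)
                   + (x B ^ 2 + 3 / 2 * x B - 3 * r) * (6 * x B + 6)).
    assert (hN : 0 < N).
    { apply Rplus_lt_0_compat; apply Rmult_lt_0_compat; nra. }
    replace (S' B) with (x' * (N / (2 * q))).
    { assert (0 < N / (2 * q)) by (apply Rdiv_lt_0_compat; lra). nra. }
    rewrite <- (is_derive_unique _ _ _ (HS B hB)). symmetry. apply is_derive_unique.
    apply (is_derive_comp (prod_sigma r) x); [|exact Hx].
    assert (HN : is_derive (fun t => (t ^ 2 + 3 / 2 * t - 3 * r)
                    * (3 * t ^ 2 + 6 * t + 9 / 4 - 3 * r)) (x B) N).
    { auto_derive; [exact I | unfold N; ring]. }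
    replace (N / (2 * q)) with (N * / (2 * q)) by reflexivity.
    apply (is_derive_comp sqrt (fun t => (t ^ 2 + 3 / 2 * t - 3 * r)
                    * (3 * t ^ 2 + 6 * t + 9 / 4 - 3 * r))); [|exact HN].
    apply is_derive_Reals. now apply derivable_pt_lim_sqrt. }
  assert (posS : forall B, D B -> 0 < prod_sigma r (x B)).
  { intros B' hB'. exact (prod_sigma_gt_0 r hr (alpha B') (alpha_I3 B' hB')). }
  assert (posP : forall B, D B -> 0 < sum_sigma r (x B)).
  { intros B' hB'. exact (sum_sigma_gt_0 r hr (alpha B') (alpha_I3 B' hB')). }
  pose proof (is_derive_quartic_int D open_energy_range (fun _ => 1) (-1 / 2)
    (fun B => prod_sigma r (x B)) (fun B => sum_sigma r (x B)) S' P' B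
    (fun y => continuous_const 1 y) posS posP HS HP (CS B hB) (CP B hB) hB) as HI.
  apply (is_derive_scal _ _ (4 * sqrt (3 * s))) in HI.
  apply (is_derive_ext_loc _ (period r s)) in HI.
  2: { apply (filter_imp D); [|now apply open_energy_range].
       intros B' hB'. symmetry. now apply period_quartic_int. }
  rewrite (is_derive_unique _ _ _ HI).
  apply Rmult_lt_0_compat.
  { assert (0 < sqrt (3 * s)) by (apply sqrt_lt_R0; lra). lra. }
  specialize (posS B hB). specialize (posP B hB).
  apply RInt_gt_0; [lra| |].
  - intros y hy. rewrite Rmult_1_l.
    assert (0 < Rpower (quartic (prod_sigma r (x B)) (sum_sigma r (x B)) y) (-1 / 2 - 1))
      by apply Rpower_gt_0.
    (* By linearity in the coefficients, positivity for the opposite coefficients gives the negative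
       sign wanted. *)
    assert (0 < quartic (- S' B) (- P' B) y) by (apply quartic_gt_0; lra).
    assert (quartic (S' B) (P' B) y < 0) by (unfold quartic in *; lra). nra.
  - intros y _.
    apply (continuous_ext (fun y => (quartic (S' B) (P' B) y * (-1 / 2)) *
       Rpower (quartic (prod_sigma r (x B)) (sum_sigma r (x B)) y) (-1 / 2 - 1))).
    { intros t. match goal with |- ?a = ?b => change (a = b :> R) end. ring. }
    apply (continuous_quartic_Rpower (fun y => quartic (S' B) (P' B) y * (-1 / 2))); auto.
    apply (ex_derive_continuous (fun y => quartic (S' B) (P' B) y * (-1 / 2))).
    unfold quartic. now auto_derive.
Qed.

(** Comparison with the limiting value sigma = 2 [alpha_min], where a = b; it is strict because
    sigma stays below this value. *)
Lemma period_gt (B : R) : D B ->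
  PI * sqrt (3 * s) / sqrt (3 / 2 * alpha_min r * (2 * alpha_min r + 1)) < period r s B.
Proof.
  intros hB. pose proof (alpha_I3 B hB) as i.
  destruct (alpha_min_spec r hr) as [l0 l1].
  destruct (sigma_spec r hr (alpha B) i) as [hx0 hx1]. fold (x B) in *.
  (* A is the common value of a^2 and b^2 when alpha = p = l, namely l (l + g) with g = 2 l +
     3/2. *)
  set (l := alpha_min r) in *. set (A := 3 / 2 * l * (2 * l + 1)).
  assert (hA : 0 < A) by (unfold A; nra).
  assert (0 < sqrt A) by now apply sqrt_lt_R0.
  assert (0 < sqrt (3 * s)) by (apply sqrt_lt_R0; lra).
  rewrite period_quartic_int by exact hB.
  apply Rle_lt_trans with (4 * sqrt (3 * s) * quartic_int (fun _ => 1) (-1 / 2) A (2 * A)).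
  - rewrite quartic_int_square by exact hA. right. field. lra.
  - apply Rmult_lt_compat_l; [lra|]. apply quartic_int_lt.
    + split; [exact (prod_sigma_gt_0 r hr (alpha B) i)|].
      rewrite <- (sqrt_pow2 A) by lra. apply sqrt_lt_1_alt.
      split; [exact (Rlt_le _ _ (prod_sigma_arg_gt_0 r hr (alpha B) i))|].
      (* These are the limiting values of alpha p and (p + g) (alpha + g), so the radicands compare
         factor by factor. *)
      replace (A ^ 2) with (l ^ 2 * (9 * (l + 1 / 2) ^ 2)) by (unfold A; field).
      apply Rmult_gt_0_lt_compat; nra.
    + split; [exact (sum_sigma_gt_0 r hr (alpha B) i)|].
      unfold sum_sigma, A. nra.
Qed.
End Energy.

(** * Specialisation to the constants given by c0, for which s0 = 1 + 4 r0 *)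

Theorem proposition3p1 (c0 : R) (hc0 : 0 < c0 < 1) :
  let r0 := r_of c0 in
  let s0 := s_of c0 in
  let T := period r0 s0 in
  (forall B : R, B_low c0 < B < 0 ->
     2 * PI * sqrt s0
     / (Rpower (1 + 4 * r0) (1 / 4) * sqrt (sqrt (1 + 4 * r0) - 1)) < T B)
  /\ smooth_on T (B_low c0) 0
  /\ (forall B : R, B_low c0 < B < 0 -> 0 < Derive T B).
Proof.
  intros r0 s0 T.
  assert (hr : 0 < r0) by (unfold r0, r_of; nra).
  assert (Es : s0 = 1 + 4 * r0) by (unfold s0, r0, s_of, r_of; ring).
  assert (hs : 0 < s0) by lra.
  assert (q1 : sqrt 1 < sqrt s0) by (apply sqrt_lt_1; lra). rewrite sqrt_1 in q1.
  assert (q2 : sqrt s0 * sqrt s0 = s0) by (apply sqrt_sqrt; lra).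
  assert (El : alpha_min r0 = (sqrt s0 - 1) / 2).
  { unfold alpha_min. rewrite Es. field. }
  (* The lower energy bound is the energy of the double root; in terms of q = sqrt s0, r0 = (q^2 -
     1) / 4 and s0^(3/2) = q^3. *)
  assert (EB : B_low c0 = energy r0 s0 (alpha_min r0)).
  { unfold B_low.
    replace (5 - 4 * c0 ^ 2) with s0 by reflexivity.
    replace (1 - c0 ^ 2) with r0 by reflexivity.
    replace (Rpower s0 (3 / 2)) with (s0 * sqrt s0).
    - unfold energy. rewrite El. replace r0 with ((s0 - 1) / 4) by lra.
      set (q := sqrt s0) in *. clearbody q. rewrite <- q2. field. lra.
    - replace (3 / 2) with (1 + / 2) by field.
      rewrite Rpower_plus, Rpower_1, Rpower_sqrt by exact hs. reflexivity. }
  rewrite EB. split; [|split].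
  - intros B hB. apply Rle_lt_trans with (2 := period_gt r0 s0 hr hs B hB). right.
    rewrite El, <- Es.
    replace (Rpower s0 (1 / 4)) with (sqrt (sqrt s0)).
    (* The factor 3 is isolated to cancel against sqrt (3 s0), and 1/4 leaves the root as the factor
       2 of the bound. *)
    + replace (3 / 2 * ((sqrt s0 - 1) / 2) * (2 * ((sqrt s0 - 1) / 2) + 1))
        with (3 * ((/ 2) ^ 2 * (sqrt s0 * (sqrt s0 - 1)))) by field.
      assert (0 < sqrt 3) by (apply sqrt_lt_R0; lra).
      assert (0 < sqrt (sqrt s0)) by (apply sqrt_lt_R0; lra).
      assert (0 < sqrt (sqrt s0 - 1)) by (apply sqrt_lt_R0; lra).
      assert (0 < sqrt s0 * (sqrt s0 - 1)) by (apply Rmult_lt_0_compat; lra).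
      rewrite !(sqrt_mult 3) by (try nra; lra).
      rewrite (sqrt_mult ((/ 2) ^ 2)) by (try apply pow2_ge_0; lra).
      rewrite sqrt_pow2, sqrt_mult by lra. field. lra.
    + replace (1 / 4) with (/ 2 * / 2) by field.
      rewrite <- Rpower_mult, !Rpower_sqrt; [reflexivity | exact hs | apply Rpower_gt_0].
  - intros n B hB.
    apply (Cn_ex_derive_n _ (open_energy_range r0 s0) n); [|exact hB].
    exact (Cn_period r0 s0 hr hs n).
  - intros B hB. exact (Derive_period_gt_0 r0 s0 hr hs B hB).
Qed.
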